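(* Let $f:(0,+\infty)\to\mathbb{R}$ be a strictly monotonic and infinitely differentiable function, and let $M$ be the associated additive mean, i.e. the mean given by $M(x,y)=f^{-1}\left(\frac{f(x)+f(y)}{2}\right)$ for all $x,y>0$. Then $$Q_M=\frac14\,\frac{f''}{f'}.$$
   Context: A mean is a function $M:(0,+\infty)^2\to(0,+\infty)$ of class $C^\infty$ such that $\min(x,y)\le M(x,y)\le\max(x,y)$ and $M(x,y)=M(y,x)$ for all $x,y>0$. In particular, the additive mean $M$ is by definition of class $C^\infty$. The characteristic function of a mean $M$ is $Q_M:(0,+\infty)\to\mathbb{R}$, $Q_M(x):=\frac{\partial^2 M}{\partial x^2}(x,x)$ (second partial derivative with respect to the first variable, evaluated at $(x,x)$). *)

(* Defs.v *)
From Stdlib Require Import Reals ClassicalEpsilon.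
From Coquelicot Require Import Coquelicot.
Open Scope R_scope.

(* Functions on (0,+oo) or (0,+oo)^2 are total functions on R or R^2 of which
   only the values at positive arguments matter.  Differentiability at a point
   of these open sets, and the derivatives there, depend only on such values. *)

Definition strictly_monotonic (f : R -> R) : Prop :=
  (forall x y, 0 < x -> x < y -> f x < f y) \/
  (forall x y, 0 < x -> x < y -> f y < f x).

Definition smooth (f : R -> R) : Prop :=
  forall (n : nat) (x : R), 0 < x -> ex_derive_n f n x.

(* [ex_diff_n M n x y]: all iterated partial derivatives of M up to order n,
   in any order of differentiation, exist and are jointly continuous at (x,y). *)
Definition smooth2 (M : R -> R -> R) : Prop :=
  forall (n : nat) (x y : R), 0 < x -> 0 < y -> ex_diff_n M n x y.

Record is_mean (M : R -> R -> R) : Prop := {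
  mean_pos : forall x y, 0 < x -> 0 < y -> 0 < M x y;
  mean_smooth : smooth2 M;
  mean_between : forall x y, 0 < x -> 0 < y ->
    Rmin x y <= M x y <= Rmax x y;
  mean_sym : forall x y, 0 < x -> 0 < y -> M x y = M y x
}.

Definition characteristic (M : R -> R -> R) (x : R) : R :=
  partial_derive 2 0 M x x.

(* The inverse of f : (0,+oo) -> f((0,+oo)); the value off the image of
   (0,+oo) is arbitrary. *)
Definition inverse (f : R -> R) (z : R) : R :=
  epsilon (inhabits 1) (fun x => 0 < x /\ f x = z).

Definition is_additive_mean (f : R -> R) (M : R -> R -> R) : Prop :=
  is_mean M /\
  forall x y, 0 < x -> 0 < y -> M x y = inverse f ((f x + f y) / 2).

(* Main.v *)
Require Import Defs.
From Stdlib Require Import Reals Ranalysis5 ClassicalEpsilon Lra.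
From Coquelicot Require Import Coquelicot.
Open Scope R_scope.

(** The inverse of [f] is never differentiated.  Instead, the definition of
    the mean is rewritten as the identity [f (M x y) = (f x + f y) / 2], and
    two derivatives in [x] give, with [M_x] and [M_xx] the partial derivatives,

      [f' (M) M_x = f' (x) / 2]  and  [f'' (M) M_x ^ 2 + f' (M) M_xx = f'' (x) / 2].

    On the diagonal [M = x]; once [M_x = 1 / 2] there, the second equation reads
    [f'' / 4 + f' M_xx = f'' / 2], which is the formula, as soon as [f' <> 0].

    The smoothness of [M] is what provides the two missing facts; a strictly
    monotonic smooth function such as [(x - 1) ^ 3] may well have a critical
    point.  Strict monotonicity only says that [f'] vanishes on no
    interval ([Derive_not_locally_zero]).
    - On the diagonal the first equation is [f' (M_x - 1 / 2) = 0].  If [M_x]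
      were not [1 / 2] at some diagonal point, then by continuity neither would
      it be at the nearby ones, and [f'] would vanish on an interval
      ([partial_mean_diagonal]).
    - If [f' (a) = 0], then [f' (M (a, v)) M_x (a, v) = 0] for every [v].  Near
      [v = a] the factor [M_x] is close to [1 / 2], so that [f' (M (a, v)) = 0];
      exchanging the variables of [M] turns this into [f' (v) = 0], again on an
      interval ([Derive_neq_0]). *)

Lemma locally_pos (a : R) : 0 < a -> locally a (fun t => 0 < t).
Proof. intros Ha; exact (open_gt 0 a Ha). Qed.

Lemma smooth_is_derive (f : R -> R) (x : R) :
  smooth f -> 0 < x -> is_derive f x (Derive f x).
Proof. intros Hf Hx; apply Derive_correct; exact (Hf 1%nat x Hx). Qed.

Lemma smooth_is_derive2 (f : R -> R) (x : R) :
  smooth f -> 0 < x -> is_derive (Derive f) x (Derive_n f 2 x).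
Proof. intros Hf Hx; apply Derive_correct; exact (Hf 2%nat x Hx). Qed.

Lemma smooth_continuity_pt (f : R -> R) (x : R) :
  smooth f -> 0 < x -> continuity_pt f x.
Proof.
  intros Hf Hx; apply continuity_pt_filterlim.
  apply (ex_derive_continuous f); exists (Derive f x).
  now apply smooth_is_derive.
Qed.

(** By the mean value theorem: otherwise [f] would take the same value at two
    distinct points. *)
Lemma Derive_not_locally_zero (f : R -> R) (a : R) :
  strictly_monotonic f -> smooth f -> 0 < a ->
  ~ locally a (fun t => Derive f t = 0).
Proof.
  intros Hmon Hf Ha [d Hd].
  assert (Hd0 := cond_pos d).
  set (b := a + d / 2).
  assert (Hab : a < b) by (unfold b; lra).
  destruct (MVT_gen f a b (Derive f)) as [c [Hc Heq]].
  - intros t Ht; rewrite Rmin_left in Ht by lra.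
    apply smooth_is_derive; [assumption | lra].
  - intros t Ht; rewrite Rmin_left in Ht by lra.
    apply smooth_continuity_pt; [assumption | lra].
  - rewrite Rmin_left, Rmax_right in Hc by lra.
    assert (H0 : Derive f c = 0).
    { apply Hd; change (Rabs (c - a) < d); apply Rabs_lt_between'.
      unfold b in Hc; lra. }
    rewrite H0 in Heq.
    destruct Hmon as [Hmon | Hmon]; specialize (Hmon a b Ha Hab); lra.
Qed.

(** Without such a [z], the choice made by [inverse f] at the midvalue would be
    arbitrary. *)
Lemma midvalue_attained (f : R -> R) (x y : R) :
  smooth f -> 0 < x -> 0 < y ->
  exists z, 0 < z /\ f z = (f x + f y) / 2.
Proof.
  intros Hf.
  (* If [f] decreases, the intermediate value theorem is applied to [- f]. *)
  assert (Hinc : forall u v, 0 < u -> u < v ->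
            exists z, 0 < z /\ f z = (f u + f v) / 2).
  { intros u v Hu Huv.
    destruct (Rle_dec (f u) (f v)) as [Hle | Hle].
    - destruct (f_interv_is_interv f u v ((f u + f v) / 2) Huv) as [z [Hz E]].
      + lra.
      + intros t Ht; apply smooth_continuity_pt; [assumption | lra].
      + exists z; split; [lra | exact E].
    - destruct (f_interv_is_interv (fun t => - f t) u v (- ((f u + f v) / 2)) Huv)
        as [z [Hz E]].
      + lra.
      + intros t Ht; apply (continuity_pt_opp f).
        apply smooth_continuity_pt; [assumption | lra].
      + exists z; split; lra. }
  intros Hx Hy.
  destruct (Rtotal_order x y) as [H | [<- | H]].
  - now apply Hinc.
  - exists x; split; [assumption | lra].
  - rewrite Rplus_comm; now apply Hinc.
Qed.

Lemma mean_diagonal (M : R -> R -> R) (x : R) :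
  is_mean M -> 0 < x -> M x x = x.
Proof.
  intros HM Hx; destruct (mean_between M HM x x Hx Hx) as [H1 H2].
  rewrite Rmin_left in H1 by lra; rewrite Rmax_left in H2 by lra; lra.
Qed.

Lemma mean_is_derive (M : R -> R -> R) (x y : R) :
  is_mean M -> 0 < x -> 0 < y ->
  is_derive (fun t => M t y) x (partial_derive 1 0 M x y).
Proof.
  intros HM Hx Hy; apply Derive_correct.
  now destruct (mean_smooth M HM 1%nat x y Hx Hy) as [_ [H _]].
Qed.

Lemma mean_is_derive2 (M : R -> R -> R) (x y : R) :
  is_mean M -> 0 < x -> 0 < y ->
  is_derive (fun t => partial_derive 1 0 M t y) x (partial_derive 2 0 M x y).
Proof.
  intros HM Hx Hy; apply Derive_correct.
  now destruct (mean_smooth M HM 2%nat x y Hx Hy) as [_ [_ [_ [[_ [H _]] _]]]].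
Qed.

Lemma mean_partial_continuity (M : R -> R -> R) (x y : R) :
  is_mean M -> 0 < x -> 0 < y ->
  continuity_2d_pt (partial_derive 1 0 M) x y.
Proof.
  intros HM Hx Hy.
  now destruct (mean_smooth M HM 1%nat x y Hx Hy) as [_ [_ [_ [[H _] _]]]].
Qed.

Lemma additive_mean_eq (f : R -> R) (M : R -> R -> R) (x y : R) :
  smooth f -> is_additive_mean f M -> 0 < x -> 0 < y ->
  f (M x y) = (f x + f y) / 2.
Proof.
  intros Hf [_ HM] Hx Hy; rewrite (HM x y Hx Hy).
  exact (proj2 (epsilon_spec (inhabits 1) _ (midvalue_attained f x y Hf Hx Hy))).
Qed.

Lemma is_derive_comp_mean (f : R -> R) (M : R -> R -> R) (x y : R) :
  smooth f -> is_mean M -> 0 < x -> 0 < y ->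
  is_derive (fun t => f (M t y)) x
    (partial_derive 1 0 M x y * Derive f (M x y)).
Proof.
  intros Hf HM Hx Hy.
  apply (is_derive_comp f (fun t => M t y)).
  - apply smooth_is_derive; [assumption | now apply mean_pos].
  - now apply mean_is_derive.
Qed.

Lemma additive_mean_derive (f : R -> R) (M : R -> R -> R) (x y : R) :
  smooth f -> is_additive_mean f M -> 0 < x -> 0 < y ->
  partial_derive 1 0 M x y * Derive f (M x y) = Derive f x / 2.
Proof.
  intros Hf HM Hx Hy.
  rewrite <- (is_derive_unique _ _ _
    (is_derive_comp_mean f M x y Hf (proj1 HM) Hx Hy)).
  rewrite (Derive_ext_loc _ (fun t => (f t + f y) / 2)).
  - apply is_derive_unique.
    assert (Hd := smooth_is_derive f x Hf Hx).
    auto_derive; [now exists (Derive f x) |].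
    change (Derive (fun t => f t) x) with (Derive f x); field.
  - generalize (locally_pos x Hx); apply filter_imp; intros t Ht.
    now apply additive_mean_eq.
Qed.

Lemma additive_mean_derive2 (f : R -> R) (M : R -> R -> R) (x y : R) :
  smooth f -> is_additive_mean f M -> 0 < x -> 0 < y ->
  partial_derive 2 0 M x y * Derive f (M x y)
  + partial_derive 1 0 M x y * (partial_derive 1 0 M x y * Derive_n f 2 (M x y))
  = Derive_n f 2 x / 2.
Proof.
  intros Hf HM Hx Hy.
  assert (HM' := proj1 HM).
  assert (Hl : is_derive
    (fun t => partial_derive 1 0 M t y * Derive f (M t y)) x
    (partial_derive 2 0 M x y * Derive f (M x y)
     + partial_derive 1 0 M x y
       * (partial_derive 1 0 M x y * Derive_n f 2 (M x y)))).
  { apply (is_derive_mult (fun t => partial_derive 1 0 M t y)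
             (fun t => Derive f (M t y))).
    - now apply mean_is_derive2.
    - apply (is_derive_comp (Derive f) (fun t => M t y)).
      + apply smooth_is_derive2; [assumption | now apply mean_pos].
      + now apply mean_is_derive.
    - exact Rmult_comm. }
  rewrite <- (is_derive_unique _ _ _ Hl).
  rewrite (Derive_ext_loc _ (fun t => Derive f t / 2)).
  - change (Derive_n f 2 x) with (Derive (Derive f) x).
    unfold Rdiv; apply Derive_scal_l.
  - generalize (locally_pos x Hx); apply filter_imp; intros t Ht.
    now apply additive_mean_derive.
Qed.

(** Differentiating [M t t = t] would give this from the symmetry of [M] and the
    total differentiability of [M]; the argument by density of the
    non-critical points of [f] takes only the continuity of one partial
    derivative. *)
Lemma partial_mean_diagonal (f : R -> R) (M : R -> R -> R) (a : R) :
  strictly_monotonic f -> smooth f -> is_additive_mean f M -> 0 < a ->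
  partial_derive 1 0 M a a = 1 / 2.
Proof.
  intros Hmon Hf HM Ha.
  destruct (Req_dec (partial_derive 1 0 M a a) (1 / 2)) as [H | H]; [assumption |].
  exfalso; apply (Derive_not_locally_zero f a Hmon Hf Ha).
  assert (He : 0 < Rabs (1 / 2 - partial_derive 1 0 M a a))
    by (apply Rabs_pos_lt; lra).
  destruct (mean_partial_continuity M a a (proj1 HM) Ha Ha (mkposreal _ He))
    as [d Hd].
  assert (Hb : locally a (fun t => Rabs (t - a) < d)) by (exists d; trivial).
  generalize (filter_and _ _ (locally_pos a Ha) Hb).
  apply filter_imp; intros t [Ht Htd].
  assert (E := additive_mean_derive f M t t Hf HM Ht Ht).
  rewrite (mean_diagonal M t (proj1 HM) Ht) in E.
  specialize (Hd t t Htd Htd); simpl pos in Hd.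
  assert (Hne : partial_derive 1 0 M t t - 1 / 2 <> 0).
  { intros E'; replace (partial_derive 1 0 M t t) with (1 / 2) in Hd by lra.
    lra. }
  apply Rmult_eq_reg_l with (partial_derive 1 0 M t t - 1 / 2);
    [lra | exact Hne].
Qed.

(** A critical point of [f] would spread: if [f' (a) = 0], the mean maps
    [(a, v)], for [v] near [a], to critical points of [f], which in turn makes
    [v] a critical point. *)
Lemma Derive_neq_0 (f : R -> R) (M : R -> R -> R) (a : R) :
  strictly_monotonic f -> smooth f -> is_additive_mean f M -> 0 < a ->
  Derive f a <> 0.
Proof.
  intros Hmon Hf HM Ha H0.
  apply (Derive_not_locally_zero f a Hmon Hf Ha).
  assert (He : 0 < 1 / 2) by lra.
  destruct (mean_partial_continuity M a a (proj1 HM) Ha Ha (mkposreal _ He))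
    as [d Hd].
  assert (Hb : locally a (fun t => Rabs (t - a) < d)) by (exists d; trivial).
  generalize (filter_and _ _ (locally_pos a Ha) Hb).
  apply filter_imp; intros v [Hv Hvd].
  assert (Haa : Rabs (a - a) < d)
    by (rewrite Rminus_diag, Rabs_R0; apply cond_pos).
  specialize (Hd a v Haa Hvd); simpl pos in Hd.
  rewrite (partial_mean_diagonal f M a Hmon Hf HM Ha) in Hd.
  apply Rabs_lt_between in Hd.
  assert (E := additive_mean_derive f M a v Hf HM Ha Hv).
  assert (Hcrit : Derive f (M a v) = 0).
  { apply Rmult_eq_reg_l with (partial_derive 1 0 M a v); lra. }
  assert (E' := additive_mean_derive f M v a Hf HM Hv Ha).
  rewrite (mean_sym M (proj1 HM) v a Hv Ha), Hcrit in E'; lra.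
Qed.

Theorem proposition3p14 :
  forall (f : R -> R) (M : R -> R -> R),
    strictly_monotonic f ->
    smooth f ->
    is_additive_mean f M ->
    forall x : R, 0 < x ->
      Derive f x <> 0 /\
      characteristic M x = 1 / 4 * (Derive_n f 2 x / Derive f x).
Proof.
  intros f M Hmon Hf HM x Hx.
  assert (Hne := Derive_neq_0 f M x Hmon Hf HM Hx).
  split; [exact Hne |].
  assert (E := additive_mean_derive2 f M x x Hf HM Hx Hx).
  rewrite (partial_mean_diagonal f M x Hmon Hf HM Hx) in E.
  rewrite (mean_diagonal M x (proj1 HM) Hx) in E.
  unfold characteristic.
  apply Rmult_eq_reg_r with (Derive f x); [| exact Hne].
  replace (1 / 4 * (Derive_n f 2 x / Derive f x) * Derive f x)
    with (Derive_n f 2 x / 4) by (field; exact Hne).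
  lra.
Qed.
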